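(* Let $a,b$ be positive integers with $\gcd(a,b)=1$. The ideal generating function of the numerical semigroup $\langle a,b\rangle$ is \[I(a,b;q)=\frac{1}{1-q^a}\binom{a+b-1}{a-1}_{q},\] where $\binom{n}{k}_q=\dfrac{\prod_{i=1}^{n}(1-q^i)}{\prod_{i=1}^{k}(1-q^i)\prod_{i=1}^{n-k}(1-q^i)}$.
   Context: $\langle a,b\rangle=\{ax+by: x,y\in\mathbb{N}\}$. A non-empty set $I\subseteq S$ is an ideal of the numerical semigroup $S$ if $I+S\subseteq I$; its codimension is $\operatorname{codim}(I)=|S\setminus I|$. The ideal generating function $I(a,b;q)$ is the formal power series $\sum_I q^{\operatorname{codim}(I)}$ over all ideals $I$ of $\langle a,b\rangle$. *)

(* Defs.v *)
From HB Require Import structures.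
From mathcomp Require Import all_boot all_order all_algebra finmap.
From mathcomp Require Import boolp classical_sets functions cardinality.

Set Implicit Arguments.
Unset Strict Implicit.
Unset Printing Implicit Defensive.

Import GRing.Theory.
Local Open Scope ring_scope.

Record fps (R : Type) := FPS { fps_coef : nat -> R }.

Notation "{ 'fps' R }" := (fps R) (format "{ 'fps'  R }") : type_scope.

Lemma fpsP (R : Type) (f g : {fps R}) :
  (forall n, fps_coef f n = fps_coef g n) <-> f = g.
Proof.
split=> [|-> //]; case: f g => [f] [g] /= fg.
by congr FPS; apply/funext.
Qed.

HB.instance Definition _ (R : Type) := gen_eqMixin {fps R}.
HB.instance Definition _ (R : Type) := gen_choiceMixin {fps R}.

Section FpsRing.
Variable R : comNzRingType.
Implicit Types f g h : {fps R}.

Definition fps_zero : {fps R} := FPS (fun _ => 0).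
Definition fps_opp f : {fps R} := FPS (fun n => - fps_coef f n).
Definition fps_add f g : {fps R} := FPS (fun n => fps_coef f n + fps_coef g n).
Definition fps_one : {fps R} := FPS (fun n => (n == 0%N)%:R).
Definition fps_mul f g : {fps R} :=
  FPS (fun n => \sum_(i < n.+1) fps_coef f i * fps_coef g (n - i)).

Fact fps_addA : associative fps_add.
Proof. by move=> f g h; apply/fpsP => n; apply: addrA. Qed.
Fact fps_addC : commutative fps_add.
Proof. by move=> f g; apply/fpsP => n; apply: addrC. Qed.
Fact fps_add0 : left_id fps_zero fps_add.
Proof. by move=> f; apply/fpsP => n; apply: add0r. Qed.
Fact fps_addN : left_inverse fps_zero fps_opp fps_add.
Proof. by move=> f; apply/fpsP => n; apply: addNr. Qed.

HB.instance Definition _ :=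
  GRing.isZmodule.Build {fps R} fps_addA fps_addC fps_add0 fps_addN.

Fact fps_mulC : commutative fps_mul.
Proof.
move=> f g; apply/fpsP => n /=; rewrite (reindex_inj rev_ord_inj) /=.
apply: eq_bigr => i _; rewrite subSS mulrC subKn //.
by rewrite -ltnS ltn_ord.
Qed.

Fact fps_mulA : associative fps_mul.
Proof.
move=> f g h; apply/fpsP => n /=.
pose c3 j k := fps_coef f j * (fps_coef g (n - j - k) * fps_coef h k).
transitivity (\sum_(j < n.+1) \sum_(k < n.+1 | (k <= n - j)%N) c3 j k).
  apply: eq_bigr => /= j _.
  have -> : \sum_(i < (n - j).+1) fps_coef g i * fps_coef h (n - j - i) =
            fps_coef (fps_mul h g) (n - j) by rewrite fps_mulC.
  rewrite /= big_distrr /= (big_ord_narrow_leq (leq_subr _ _)).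
  by apply: eq_bigr => k _; rewrite /c3 /= [X in _ * X]mulrC.
rewrite (exchange_big_dep predT) //=.
transitivity (fps_coef (fps_mul h (fps_mul f g)) n); last by rewrite fps_mulC.
apply: eq_bigr => k _.
transitivity (\sum_(j < n.+1 | (j <= n - k)%N) c3 j k).
  apply: eq_bigl => j; rewrite -ltnS -(ltnS j) -!subSn ?leq_ord //.
  by rewrite -subn_gt0 -(subn_gt0 j) -!subnDA addnC.
rewrite (big_ord_narrow_leq (leq_subr _ _)) /= big_distrr /=.
by apply: eq_bigr => j _; rewrite /c3 /= -!subnDA addnC mulrA [RHS]mulrC.
Qed.

Fact fps_mul1 : left_id fps_one fps_mul.
Proof.
move=> f; apply/fpsP => n /=; rewrite big_ord_recl /= mul1r subn0 big1 ?addr0 //.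
by move=> i _; rewrite mul0r.
Qed.

Fact fps_mulD : left_distributive fps_mul fps_add.
Proof.
move=> f g h; apply/fpsP => n /=; rewrite -big_split /=.
by apply: eq_bigr => i _; rewrite mulrDl.
Qed.

Fact fps_one_neq0 : fps_one != fps_zero.
Proof. by apply/eqP => /fpsP /(_ 0%N) /eqP; rewrite /= oner_eq0. Qed.

HB.instance Definition _ := GRing.Zmodule_isComNzRing.Build {fps R}
  fps_mulA fps_mulC fps_mul1 fps_mulD fps_one_neq0.

Definition fpsX : {fps R} := FPS (fun n => (n == 1%N)%:R).
Definition fpsC (c : R) : {fps R} := FPS (fun n => c *+ (n == 0%N)).

Lemma coef_fps0 n : fps_coef (0 : {fps R}) n = 0. Proof. by []. Qed.
Lemma coef_fps1 n : fps_coef (1 : {fps R}) n = (n == 0%N)%:R.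
Proof. by []. Qed.
Lemma coef_fpsD f g n : fps_coef (f + g) n = fps_coef f n + fps_coef g n.
Proof. by []. Qed.
Lemma coef_fpsN f n : fps_coef (- f) n = - fps_coef f n. Proof. by []. Qed.
Lemma coef_fpsB f g n : fps_coef (f - g) n = fps_coef f n - fps_coef g n.
Proof. by []. Qed.
Lemma coef_fpsM f g n :
  fps_coef (f * g) n = \sum_(i < n.+1) fps_coef f i * fps_coef g (n - i).
Proof. by []. Qed.
Lemma coef_fps_sum (I : Type) (r : seq I) (P : pred I) (F : I -> {fps R}) n :
  fps_coef (\sum_(i <- r | P i) F i) n = \sum_(i <- r | P i) fps_coef (F i) n.
Proof. by apply: (big_morph (fun f => fps_coef f n)). Qed.

Lemma coef_fpsCM c f n : fps_coef (fpsC c * f) n = c * fps_coef f n.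
Proof.
rewrite coef_fpsM big_ord_recl /= subn0 mulr1n big1 ?addr0 // => i _.
by rewrite mulr0n mul0r.
Qed.

Lemma coef_fpsX_low f k n :
  fps_coef f 0 = 0 -> (n < k)%N -> fps_coef (f ^+ k) n = 0.
Proof.
move=> f0; elim: k n => // k IHk n nk.
rewrite exprS coef_fpsM big_ord_recl /= f0 mul0r add0r big1 // => i _.
by rewrite IHk ?mulr0 // /bump /=; case: n nk i => [|n] nk [i //= _]; rewrite subSS (leq_ltn_trans (leq_subr _ _)).
Qed.

End FpsRing.

Section FpsUnitRing.
Variable R : comUnitRingType.
Implicit Types f g : {fps R}.

Definition fps_unit : {pred {fps R}} :=
  fun f => fps_coef f 0 \is a GRing.unit.

(* With u = 1 / f_0, this is the geometric series u * \sum_k (1 - u f)^k, whose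
   terms with k > n do not contribute to the coefficient of degree n.  As for
   any [unitRingType], a non-invertible series is its own inverse. *)
Definition fps_inv f : {fps R} :=
  if f \in fps_unit then
    let u := (fps_coef f 0)^-1 in
    FPS (fun n => u * fps_coef (\sum_(k < n.+1) (1 - fpsC u * f) ^+ k) n)
  else f.

Fact fps_mulVf : {in fps_unit, left_inverse 1 fps_inv *%R}.
Proof.
move=> f fU; rewrite /fps_inv fU; apply/fpsP => n.
have f0U : fps_coef f 0 \is a GRing.unit by [].
set u := (fps_coef f 0)^-1; set h := 1 - fpsC u * f.
have h0 : fps_coef h 0 = 0.
  by rewrite coef_fpsB coef_fpsCM coef_fps1 mulVr ?subrr.
pose G := \sum_(k < n.+1) h ^+ k.
have GE m : (m <= n)%N -> fps_coef (\sum_(k < m.+1) h ^+ k) m = fps_coef G m.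
  move=> mn; rewrite /G !coef_fps_sum -ltnS in mn *.
  rewrite -!(big_mkord xpredT (fun k => fps_coef (h ^+ k) m)).
  rewrite (big_cat_nat _ (n := m.+1) (p := n.+1)) //= [X in _ + X]big_nat_cond.
  rewrite [X in _ + X]big1 ?addr0 // => k /andP[/andP[mk _] _].
  exact: coef_fpsX_low.
transitivity (fps_coef (fpsC u * G * f) n).
  rewrite !coef_fpsM; apply: eq_bigr => i _ /=; congr (_ * _).
  by rewrite GE ?leq_ord // -coef_fpsCM.
have -> : fpsC u * G * f = 1 - h ^+ n.+1.
  rewrite -mulrA [G * f]mulrC mulrA -[fpsC u * f](subKr 1) -/h.
  rewrite -[in RHS](expr1n _ n.+1) subrXX; congr (_ * _).
  by apply: eq_bigr => i _; rewrite expr1n mul1r.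
by rewrite coef_fpsB coef_fpsX_low ?subr0.
Qed.

Fact fps_unitPl f g : g * f = 1 -> fps_unit f.
Proof.
move=> /fpsP /(_ 0%N); rewrite coef_fpsM big_ord1 subnn /= => gf1.
by apply/unitrPr; exists (fps_coef g 0); rewrite mulrC.
Qed.

Fact fps_inv_out : {in [predC fps_unit], fps_inv =1 id}.
Proof. by move=> f; rewrite inE /= /fps_inv => /negPf ->. Qed.

HB.instance Definition _ := GRing.ComNzRing_hasMulInverse.Build {fps R}
  fps_mulVf fps_unitPl fps_inv_out.

End FpsUnitRing.

Definition q : {fps int} := fpsX int.

Definition qbinomial (n k : nat) : {fps int} :=
  (\prod_(1 <= i < n.+1) (1 - q ^+ i)) /
  ((\prod_(1 <= i < k.+1) (1 - q ^+ i)) *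
   (\prod_(1 <= i < (n - k).+1) (1 - q ^+ i))).

Lemma one_sub_qX_unit i : (0 < i)%N -> 1 - q ^+ i \is a GRing.unit.
Proof.
by move=> i0; rewrite unfold_in /= /fps_unit coef_fpsB coef_fpsX_low // subr0.
Qed.

Lemma qbinomial_den_unit k :
  \prod_(1 <= i < k.+1) (1 - q ^+ i) \is a GRing.unit.
Proof.
rewrite big_nat_cond; apply: rpred_prod => i /andP[/andP[i0 _] _].
exact: one_sub_qX_unit.
Qed.

Local Close Scope ring_scope.
Local Open Scope classical_set_scope.

Definition semigroup2 (a b : nat) : set nat :=
  [set n | exists x y, n = a * x + b * y].

Definition semigroup_ideal (S I : set nat) : Prop :=
  [/\ I !=set0, I `<=` S & forall i s, I i -> S s -> I (i + s)].

(* [fset_set] sends infinite sets to [fset0]; see [finite_semigroup2D] and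
   [finite_ideals_codim] below for the finiteness of the sets it is used on. *)
Definition codim (S I : set nat) : nat := #|` fset_set (S `\` I)|.

Definition ideals_of_codim (S : set nat) (n : nat) : set (set nat) :=
  [set I | semigroup_ideal S I /\ codim S I = n].

Definition ideal_gf (a b : nat) : {fps int} :=
  FPS (fun n => Posz #|` fset_set (ideals_of_codim (semigroup2 a b) n)|).

Lemma semigroup2_large a b n : 0 < a -> 0 < b -> coprime a b ->
  a * b <= n -> semigroup2 a b n.
Proof.
move=> a0 b0 cab abn; pose y := chinese a b 0 n %% (a * b).
have yn : y <= n by apply: leq_trans abn; rewrite ltnW ?ltn_mod ?muln_gt0 ?a0.
have ya : a %| y.
  rewrite /dvdn modn_dvdm ?dvdn_mulr //.
  by have := chinese_modl cab 0 n; rewrite mod0n => ->.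
have yb : b %| n - y.
  rewrite -eqn_mod_dvd // eq_sym modn_dvdm ?dvdn_mull //.
  by rewrite chinese_modr.
exists (y %/ a), ((n - y) %/ b).
by rewrite ![_ * (_ %/ _)]mulnC !divnK // subnKC.
Qed.

Lemma finite_semigroup2D a b (I : set nat) : 0 < a -> 0 < b -> coprime a b ->
  semigroup_ideal (semigroup2 a b) I -> finite_set (semigroup2 a b `\` I).
Proof.
move=> a0 b0 cab [[x Ix] _ IS].
apply: (@sub_finite_set _ _ `I_(x + a * b)); last exact: finite_II.
move=> y [_ nIy] /=; rewrite ltnNge; apply/negP => xy; apply: nIy.
have xy' : x <= y by apply: leq_trans xy; apply: leq_addr.
rewrite -(subnKC xy'); apply: IS => //; apply: semigroup2_large => //.
by rewrite leq_subRL.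
Qed.

Lemma finite_ideals_codim a b n : 0 < a -> 0 < b -> coprime a b ->
  finite_set (ideals_of_codim (semigroup2 a b) n).
Proof.
move=> a0 b0 cab; set S := semigroup2 a b; pose N := (a * n + b * n).+1.
have bnd I : semigroup_ideal S I -> codim S I = n -> S `\` I `<=` `I_N.
  move=> idI cI.
  have finD := finite_semigroup2D a0 b0 cab idI.
  have few (c : nat -> nat) m : injective c ->
      (forall k, k <= m -> (S `\` I) (c k)) -> m < n.
    move=> cinj cD; rewrite -cI /codim.
    have <- : #|` [fset c (val k) | k in 'I_m.+1]%fset| = m.+1.
      by rewrite card_imfset /= ?size_enum_ord // => k l /cinj/val_inj.
    apply/fsubset_leq_card/fsubsetP => z /imfsetP[k _ ->].
    by rewrite in_fset_set //; apply/mem_set/cD; rewrite -ltnS ltn_ord.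
  move=> y [[i [j yE]] nIy].
  have sub u v u' v' : y = a * (u + u') + b * (v + v') ->
      (S `\` I) (a * u + b * v).
    move=> yE'; split; first by exists u, v.
    move=> Iz; apply: nIy; case: idI => _ _ /(_ _ (a * u' + b * v') Iz).
    by rewrite yE' !mulnDr addnACA; apply; exists u', v'.
  have ilt : i < n.
    apply: (few (fun k => a * k + b * j)) => [k l /addIn /eqP|k ki].
      by rewrite eqn_pmul2l // => /eqP.
    by apply: (sub _ _ (i - k) 0); rewrite subnKC // addn0.
  have jlt : j < n.
    apply: (few (fun k => a * i + b * k)) => [k l /addnI /eqP|k kj].
      by rewrite eqn_pmul2l // => /eqP.
    by apply: (sub _ _ 0 (j - k)); rewrite subnKC // addn0.
  by rewrite /= ltnS yE leq_add // leq_mul2l ltnW ?orbT.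
pose F (A : {set 'I_N}) : set nat :=
  S `\` [set k | exists2 i, i \in A & val i = k].
apply: (@sub_finite_set _ _ (range F)).
  move=> I [idI cI]; exists [set i : 'I_N | `[< (S `\` I) (val i) >]]%SET => //.
  apply/seteqP; split=> k; last first.
    case: (idI) => _ IS _ Ik; split; first exact: IS.
    by case=> i; rewrite inE => /asboolP[_ nI] ik; apply: nI; rewrite ik.
  move=> [Sk nk]; apply: contrapT => nIk; apply: nk.
  have kN : k < N by apply: (bnd I idI cI).
  by exists (Ordinal kN); rewrite // inE; apply/asboolP.
exact/finite_image/finite_finset.
Qed.

(* Main.v *)
(** Every element of <a, b> is uniquely b j + a t with j < a.  An ideal I is
    determined by the least c_j such that b j + a c_j lies in I, and stability
    under a and b means c_0 >= c_1 >= ... >= c_(a-1) and c_0 <= c_(a-1) + b,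
    while codim I is the sum of the c_j.  Subtracting m = c_(a-1) leaves a
    partition s with a - 1 parts in [0, b], and codim I = a m + |s|: the factor
    1 / (1 - q^a) counts m, and the Gaussian binomial counts s. *)
Require Import Defs.
From mathcomp Require Import all_boot all_order all_algebra.
From mathcomp Require Import finmap boolp classical_sets functions cardinality.
From mathcomp Require Import zify ring.
Import GRing.Theory.
Local Open Scope ring_scope.

Set Implicit Arguments.
Unset Strict Implicit.
Unset Printing Implicit Defensive.

(** * Multiplication by powers of [q] *)

Lemma coef_fpsXn n k : fps_coef (q ^+ n) k = (k == n)%:R.
Proof.
elim: n k => [|n IHn] k //; rewrite exprS coef_fpsM.
case: k => [|k]; first by rewrite big_ord1 mul0r.
rewrite !big_ord_recl /= mul0r add0r mul1r big1 ?addr0 => [|i _].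
  by rewrite IHn /bump /= subn1.
by rewrite mul0r.
Qed.

Lemma coef_fpsXnM n (f : {fps int}) k :
  (k < n)%N -> fps_coef (q ^+ n * f) k = 0.
Proof.
move=> kn; rewrite coef_fpsM big1 // => i _.
rewrite coef_fpsXn; case: eqP => [ik|]; last by rewrite mul0r.
by have := ltn_ord i; lia.
Qed.

(** * Partitions in a box and Gaussian binomials *)

(** Each entry bounds the next, and zeros are allowed: length exactly [k] stands for at most [k]
    nonzero parts. *)
Fixpoint box_partitions (k b : nat) : seq (seq nat) :=
  if k is k'.+1 then [seq i :: s | i <- iota 0 b.+1, s <- box_partitions k' i]
  else [:: [::]].

Lemma box_partitionsS k b : box_partitions k.+1 b =
  [seq i :: s | i <- iota 0 b.+1, s <- box_partitions k i].
Proof. by []. Qed.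

Lemma mem_box_partitions k b s :
  (s \in box_partitions k b) = (size s == k) && path geq b s.
Proof.
elim: k b s => [|k IHk] b s; first by rewrite inE; case: s.
rewrite box_partitionsS; apply/allpairsPdep/idP => [[i [t [ib tk ->]]]|].
  by move: tk ib; rewrite IHk mem_iota /= => /andP[/eqP -> ->]; lia.
case: s => [//|i s] /andP[/eqP[sk] /andP[ib pis]].
exists i, s; split=> //; first by rewrite mem_iota; move: ib => /=; lia.
by rewrite IHk sk eqxx.
Qed.

Lemma box_partitions_uniq k b : uniq (box_partitions k b).
Proof.
elim: k b => [//|k IHk] b; rewrite box_partitionsS.
apply: allpairs_uniq_dep => [|i _|].
- exact: iota_uniq.
- exact: IHk.
by move=> [i s] [j t] _ _ /= [-> ->].
Qed.

Definition box_gf k b : {fps int} :=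
  \sum_(s <- box_partitions k b) q ^+ sumn s.

Lemma box_gfS k b : box_gf k.+1 b = \sum_(0 <= i < b.+1) q ^+ i * box_gf k i.
Proof.
rewrite /box_gf box_partitionsS big_allpairs_dep /index_iota subn0.
apply: eq_bigr => i _; rewrite mulr_sumr; apply: eq_bigr => s _.
by rewrite exprD.
Qed.

(** Double induction along the q-Pascal rule; with denominators cleared, every step is a polynomial
    identity. *)
Lemma box_gfE k b :
  box_gf k b * ((\prod_(1 <= i < k.+1) (1 - q ^+ i)) *
                (\prod_(1 <= i < b.+1) (1 - q ^+ i))) =
  \prod_(1 <= i < (k + b).+1) (1 - q ^+ i).
Proof.
elim: k b => [|k IHk] b.
  by rewrite /box_gf big_seq1 !mul1r big_geq // mul1r.
elim: b => [|b IHb].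
  have -> : box_gf k.+1 0 = box_gf k 0 by rewrite box_gfS big_nat1 mul1r.
  rewrite addn0 [\prod_(1 <= i < k.+2) _]big_nat_recr //=.
  by have := IHk 0%N; rewrite addn0 => E; rewrite -{2}E; ring.
(* q-Pascal rule: the first entry is at most [b], or equals [b.+1] and leaves [k] entries still
   bounded by [b.+1]. *)
have -> : box_gf k.+1 b.+1 = box_gf k.+1 b + q ^+ b.+1 * box_gf k b.+1.
  by rewrite !box_gfS big_nat_recr.
rewrite addnS [RHS]big_nat_recr //=.
have IHk' := IHk b.+1.
rewrite [\prod_(1 <= i < k.+2) _]big_nat_recr //= in IHb *.
rewrite [\prod_(1 <= i < b.+2) _]big_nat_recr //= in IHk' *.
rewrite addnS -addSn in IHk'.
set K := \prod_(1 <= i < k.+1) _ in IHb IHk' *.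
set B := \prod_(1 <= i < b.+1) _ in IHb IHk' *.
set N := \prod_(1 <= i < (k.+1 + b).+1) _ in IHb IHk' *.
(* The last factor of the target splits as 1 - q^(b+k+2) = (1 - q^(b+1)) + q^(b+1) (1 - q^(k+1)),
   one term per induction hypothesis. *)
transitivity (N * (1 - q ^+ b.+1) + q ^+ b.+1 * (1 - q ^+ k.+1) * N).
  by rewrite -{1}IHb -IHk'; ring.
rewrite (_ : (k.+1 + b).+1 = b.+1 + k.+1)%N ?exprD; first ring.
by lia.
Qed.

Lemma box_gf_qbinomial k b : box_gf k b = qbinomial (k + b) k.
Proof.
rewrite /qbinomial addKn -box_gfE mulrK //.
by rewrite unitrM !qbinomial_den_unit.
Qed.

(** * The geometric factor *)

(** The tail cut off is a multiple of q^(a(n+1)), and a(n+1) > n because [a] is positive. *)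
Lemma coef_geometricM a (f : {fps int}) n : (0 < a)%N ->
  fps_coef (1 / (1 - q ^+ a) * f) n =
  fps_coef (\sum_(m < n.+1) q ^+ (a * m) * f) n.
Proof.
move=> a0; have aU := one_sub_qX_unit a0.
have geom : (1 - q ^+ a) * (\sum_(m < n.+1) q ^+ (a * m)) = 1 - q ^+ (a * n.+1).
  rewrite exprM -[in RHS](expr1n _ n.+1) subrXX; congr (_ * _).
  by apply: eq_bigr => m _; rewrite expr1n mul1r exprM.
have -> : \sum_(m < n.+1) q ^+ (a * m) * f =
    1 / (1 - q ^+ a) * f - q ^+ (a * n.+1) * (1 / (1 - q ^+ a) * f).
  rewrite -mulr_suml -(mulKr aU (\sum_(m < n.+1) _)) geom.
  by ring.
rewrite coef_fpsB coef_fpsXnM ?subr0 //.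
by nia.
Qed.

Local Close Scope ring_scope.
Local Open Scope classical_set_scope.

(** Serves twice: to count the gaps of a staircase and to count the ideals of given codimension. *)
Lemma card_fset_set_image (T U : choiceType) (f : T -> U) (s : seq T) :
  uniq s -> {in s &, injective f} ->
  #|` fset_set (f @` [set` s])| = size s.
Proof.
move=> s_uniq f_inj.
have -> : fset_set (f @` [set` s]) = [fset f x | x in s]%fset.
  apply/fsetP => y; rewrite in_fset_set; last exact/finite_image/finite_seq.
  apply/idP/imfsetP => [/set_mem[x xs <-]|[x xs ->]]; first by exists x.
  by apply/mem_set; exists x.
by rewrite card_in_imfset //= undup_id.
Qed.

(** * Ideals as staircases *)

Definition staircase (a b : nat) (c : nat -> nat) : set nat :=
  [set z | exists j t, [/\ j < a, c j <= t & z = b * j + a * t]].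

Section Staircase.
Variables a b : nat.
Hypotheses (a_gt0 : 0 < a) (cop_ab : coprime a b).

Let S := semigroup2 a b.

(** Euclidean division of the coefficient of [b] by [a] moves multiples of [a * b] into the
    coefficient of [a]. *)
Lemma semigroup2P z : S z <-> exists j t, j < a /\ z = b * j + a * t.
Proof.
split=> [[x [y ->]]|[j [t [_ ->]]]]; last by exists t, j; rewrite addnC.
exists (y %% a), (x + b * (y %/ a)); split; first by rewrite ltn_mod.
by rewrite {1}(divn_eq y a); nia.
Qed.

(** Modulo [a] the equation reads b j = b j', and [b] is invertible modulo [a]. *)
Lemma semigroup2_inj j t j' t' : j < a -> j' < a ->
  b * j + a * t = b * j' + a * t' -> j = j' /\ t = t'.
Proof.
move=> ja j'a E.
have jj' : j = j'.
  apply/eqP; rewrite -(modn_small ja) -(modn_small j'a).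
  wlog le : j t j' t' ja j'a E / j <= j'.
    move=> H; case/orP: (leq_total j j') => le; first exact: H E le.
    by rewrite eq_sym; apply: H (esym E) le.
  rewrite eq_sym eqn_mod_dvd // -(Gauss_dvdr _ cop_ab).
  by apply/dvdnP; exists (t - t'); nia.
by subst j'; split=> //; nia.
Qed.

Lemma mem_staircase c j t : j < a ->
  staircase a b c (b * j + a * t) <-> c j <= t.
Proof.
move=> ja; split=> [[j' [t' [j'a ct]]]|ct]; last by exists j, t.
by move=> /(semigroup2_inj ja j'a)[-> ->].
Qed.

Lemma staircase_ideal c :
  (forall j, j.+1 < a -> c j.+1 <= c j) -> c 0 <= c a.-1 + b ->
  semigroup_ideal S (staircase a b c).
Proof.
move=> c_dec c_wrap; split.
- by exists (b * 0 + a * c 0); exists 0, (c 0).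
- by move=> z [j [t [ja _ ->]]]; exists t, j; rewrite addnC.
have addb z : staircase a b c z -> staircase a b c (z + b).
  move=> [j [t [ja ct ->]]]; have [j1a|j1a] := ltnP j.+1 a.
    by exists j.+1, t; split=> //; [apply: leq_trans (c_dec _ j1a) ct | nia].
  have jE : j = a.-1 by lia.
  (* Wrap-around: b (a - 1) + b = a b, so the last column leads back to column 0, raised by [b]. *)
  by exists 0, (t + b); split=> //; [rewrite jE in ct; lia | nia].
move=> z s Iz [x [y ->]]; rewrite addnA.
have {Iz} : staircase a b c (z + a * x).
  move: Iz => [j [t [ja ct ->]]]; exists j, (t + x); split=> //; first by lia.
  by rewrite mulnDr addnA.
elim: y => [|y IHy] H; first by rewrite muln0 addn0.
by rewrite mulnS addnCA addnC; apply: addb; apply: IHy.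
Qed.

(** The gaps are the points strictly below the profile, [c j] of them in column [j]. *)
Lemma codim_staircase c : codim S (staircase a b c) = \sum_(j < a) c j.
Proof.
rewrite /codim.
pose r := [seq (j, t) | j <- iota 0 a, t <- iota 0 (c j)].
have mem_r j t : ((j, t) \in r) = (j < a) && (t < c j).
  apply/allpairsPdep/idP => [[j' [t' []]]|/andP[ja tc]].
    by rewrite !mem_iota => j'a t'c [-> ->]; lia.
  by exists j, t; rewrite !mem_iota.
have -> : S `\` staircase a b c = (fun p => b * p.1 + a * p.2) @` [set` r].
  apply/seteqP; split=> [z [/semigroup2P[j [t [ja ->]]]]|z [[j t] /=]].
    rewrite mem_staircase // => /negP; rewrite -ltnNge => tc.
    by exists (j, t) => //=; rewrite mem_r ja.
  rewrite mem_r => /andP[ja tc] <-; split.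
    by apply/semigroup2P; exists j, t.
  by rewrite mem_staircase //; lia.
rewrite card_fset_set_image.
- rewrite size_allpairs_dep sumnE big_map -(big_mkord xpredT c).
  by rewrite /index_iota subn0; apply: eq_bigr => j _; rewrite size_iota.
- apply: allpairs_uniq_dep => [|j _|]; try exact: iota_uniq.
  by move=> [i s] [j t] _ _ /= [-> ->].
move=> [j t] [j' t']; rewrite !mem_r => /andP[ja _] /andP[j'a _] /=.
by move=> /(semigroup2_inj ja j'a)[-> ->].
Qed.

Lemma ideal_staircase (I : set nat) : semigroup_ideal S I ->
  exists c, [/\ I = staircase a b c,
    forall j, j.+1 < a -> c j.+1 <= c j & c 0 <= c a.-1 + b].
Proof.
move=> [[x Ix] IS Iadd].
have Ia z t : I z -> I (z + a * t).
  by move=> Iz; apply: Iadd => //; exists t, 0; rewrite muln0 addn0.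
have Ib z t : I z -> I (z + b * t).
  by move=> Iz; apply: Iadd => //; exists 0, t; rewrite muln0.
have exI j : exists t, `[< I (b * j + a * t) >].
  have /semigroup2P[j0 [t0 [j0a xE]]] := IS _ Ix.
  (* Raising by [b] pays for a full turn through the columns, so any column is reached from [x] by
     adding copies of [b]. *)
  exists (t0 + b); apply/asboolP.
  have -> : b * j + a * (t0 + b) = x + b * (a - j0 + j) by rewrite xE; nia.
  exact: Ib.
pose c j := ex_minn (exI j).
have cI j t : c j <= t <-> I (b * j + a * t).
  rewrite /c; case: ex_minnP => u /asboolP Iu u_min; split.
    by move=> /subnKC <-; rewrite mulnDr addnA; apply: Ia.
  by move=> It; apply/u_min/asboolP.
exists c; split.
- apply/seteqP; split=> [z Iz|z [j [t [_ /cI It ->]]] //].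
  have /semigroup2P[j [t [ja zE]]] := IS _ Iz.
  by exists j, t; split=> //; apply/cI; rewrite -zE.
(* Both inequalities come from adding [b] to the lowest element of a column; after column [a.-1]
   this lands in column 0. *)
- move=> j _; apply/cI; have /cI/(Ib _ 1) := leqnn (c j).
  by congr I; nia.
apply/cI; have /cI/(Ib _ 1) := leqnn (c a.-1).
by congr I; nia.
Qed.

Lemma eq_staircase c c' : (forall j, j < a -> c j = c' j) ->
  staircase a b c = staircase a b c'.
Proof.
by move=> E; apply/seteqP; split=> _ [j [t [ja ct ->]]]; exists j, t;
  split=> //; rewrite ?E // -E.
Qed.

Lemma staircase_inj c c' : staircase a b c = staircase a b c' ->
  forall j, j < a -> c j = c' j.
Proof.
move=> E j ja; apply/eqP; rewrite eqn_leq; apply/andP; split.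
  by apply/(mem_staircase _ _ ja); rewrite E; apply/mem_staircase.
by apply/(mem_staircase _ _ ja); rewrite -E; apply/mem_staircase.
Qed.

(** * Counting ideals by codimension *)

(* The default value of [nth] provides the last entry c_(a-1) - m = 0. *)
Definition box_staircase (p : nat * seq nat) : set nat :=
  staircase a b (fun j => p.1 + nth 0 p.2 j).

Lemma card_ideals_of_codim n :
  #|` fset_set (ideals_of_codim S n)| =
  \sum_(m < n.+1) count (fun s => a * m + sumn s == n) (box_partitions a.-1 b).
Proof.
pose r := [seq (m, s) | m <- iota 0 n.+1,
  s <- [seq s <- box_partitions a.-1 b | a * m + sumn s == n]].
have mem_r m s : (m, s) \in r =
    [&& size s == a.-1, path geq b s & a * m + sumn s == n].
  apply/allpairsPdep/idP => [[m' [s' []]]|/and3P[sa ps mn]].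
    rewrite mem_filter mem_box_partitions => _ /andP[mn /andP[sa ps]] [-> ->].
    by rewrite sa ps.
  exists m, s; rewrite mem_filter mem_box_partitions sa ps mn mem_iota.
  (* Since [a] is positive, a m <= n forces m <= n, so the range of [m] loses no pair. *)
  by split=> //; move: mn => /eqP; nia.
have sumE m s : size s = a.-1 ->
    \sum_(j < a) (m + nth 0 s j) = a * m + sumn s.
  move=> sa; rewrite big_split /= sum_nat_const card_ord; congr (_ + _).
  (* There is one more column than entries in [s]; the last one contributes the default 0. *)
  rewrite -(prednK a_gt0) big_ord_recr /= nth_default ?sa // addn0.
  by rewrite sumnE (big_nth 0) sa big_mkord.
have -> : ideals_of_codim S n = box_staircase @` [set` r].
  apply/seteqP; split=> [I [/ideal_staircase[c [-> c_dec c_wrap]] cn]|].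
    have c_le i j : i <= j -> j < a -> c j <= c i.
      elim: j => [|j IHj]; first by rewrite leqn0 => /eqP ->.
      rewrite leq_eqVlt => /predU1P[-> //|ij] ja.
      exact: leq_trans (c_dec j ja) (IHj ij (ltnW ja)).
    (* The truncated subtraction is exact here, as [c] attains its minimum over the columns at
       [a.-1]. *)
    pose s := mkseq (fun j => c j - c a.-1) a.-1.
    have cE j : j < a -> c a.-1 + nth 0 s j = c j.
      move=> ja; have [ja1|ja1] := ltnP j a.-1.
        by rewrite nth_mkseq // subnKC //; apply: c_le; lia.
      rewrite nth_default ?size_mkseq // addn0.
      by congr c; lia.
    exists (c a.-1, s); last exact: eq_staircase.
    rewrite /= mem_r size_mkseq eqxx -sumE ?size_mkseq //=; apply/andP; split.
      (* At index 0 the path condition compares with [b] and is [c_wrap]; at later indices it is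
         [c_dec]. *)
      apply/(pathP 0); rewrite size_mkseq => -[|i] ia /=.
        by rewrite nth_mkseq //; lia.
      rewrite !nth_mkseq //; last exact: ltnW.
      by apply: leq_sub2r; apply: c_dec; lia.
    by rewrite -cn codim_staircase; apply/eqP/eq_bigr => j _; apply: cE.
  move=> _ [[m s] /= + <-]; rewrite mem_r => /and3P[/eqP sa ps /eqP mn].
  split; last by rewrite codim_staircase sumE.
  move/(pathP 0): ps => ps; apply: staircase_ideal => /= [j ja|].
    rewrite leq_add2l; have [js|js] := ltnP j.+1 (size s).
      exact: ps js.
    by rewrite nth_default.
  rewrite (nth_default 0 (n := a.-1)) ?sa // addn0 leq_add2l.
  by case: s {sa mn} ps => [//|x s] /(_ 0); apply.
rewrite card_fset_set_image.
- rewrite size_allpairs_dep sumnE big_map.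
  rewrite -(big_mkord xpredT (fun m =>
    count (fun s => a * m + sumn s == n) (box_partitions a.-1 b))).
  rewrite /index_iota subn0; apply: eq_bigr => m _.
  by rewrite size_filter.
- apply: allpairs_uniq_dep => [|m _|].
  + exact: iota_uniq.
  + exact/filter_uniq/box_partitions_uniq.
  by move=> [i s] [j t] _ _ /= [-> ->].
move=> [m s] [m' s']; rewrite !mem_r.
move=> /and3P[/eqP sa _ _] /and3P[/eqP s'a _ _] /staircase_inj /= E.
(* Column [a.-1] lies past the end of both lists, so its height is [m] itself. *)
have mm' : m = m'.
  have := E a.-1; rewrite !nth_default ?sa ?s'a // !addn0; apply.
  by lia.
congr pair => //; apply: (@eq_from_nth _ 0); first by rewrite sa.
move=> j; rewrite sa => ja1; have ja : j < a by lia.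
by have := E j ja; rewrite mm' => /addnI.
Qed.

End Staircase.

Local Close Scope classical_set_scope.
Local Open Scope ring_scope.

Theorem theorem3p5 (a b : nat) (a_gt0 : (0 < a)%N) (b_gt0 : (0 < b)%N)
    (gcd_ab : gcdn a b = 1%N) :
  ideal_gf a b = 1 / (1 - q ^+ a) * qbinomial (a + b - 1) (a - 1).
Proof.
rewrite (_ : (a + b - 1 = a.-1 + b)%N) ?subn1; last by lia.
rewrite -box_gf_qbinomial; apply/fpsP => n.
rewrite coef_geometricM // coef_fps_sum [LHS]/=.
rewrite card_ideals_of_codim //; last exact/eqP.
rewrite -natz natr_sum; apply: eq_bigr => m _.
(* For fixed [m], both sides become sums over [s] of the indicator of a m + |s| = n. *)
rewrite /box_gf mulr_sumr coef_fps_sum -sum1_count natr_sum big_mkcond.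
apply: eq_bigr => s _; rewrite -exprD coef_fpsXn eq_sym.
by case: eqP.
Qed.
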